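(* Let $H$ be a hypergraph. If $\mathfrak{R}$ is an equivalence relation on $V(H)$ such that $\mathfrak{R}$ is finer than the equivalence relation $\mathfrak{R}_{A_{(w,H)}}$, then for each $\mathfrak{R}$-equivalence class $W$, the adjacency matrix $A_{(w,H)}$ has an eigenvalue $-(s_u,s_v)_w$ of multiplicity $|W|-1$, where $u,v\in W$ with $v\neq u$.
   Context: A hypergraph $H$ is a pair $(V(H),E(H))$ with $V(H)$ a non-empty set (vertices) and $E(H)$ a set of non-empty subsets of $V(H)$ (hyperedges). The edge-vertex incidence matrix $B_H=[b_{ev}]_{e\in E(H),v\in V(H)}$ has $b_{ev}=1$ if $v\in e$ and $b_{ev}=0$ otherwise. For $v\in V(H)$, $s_v:E(H)\to\mathbb{C}$ denotes the column of $B_H$ indexed by $v$. Let $w:E(H)\to(0,\infty)$ be a positive-valued function. For $x,y:E(H)\to\mathbb{C}$, $(x,y)_w=\sum_{e\in E(H)}w(e)x(e)y(e)$. The star of a vertex $v$ is $E_v(H)=\{e\in E(H): v\in e\}$. $A_{(w,H)}=[a_{uv}]_{u,v\in V(H)}$ is the matrix with $a_{uv}=\sum_{e\in E_u(H)\cap E_v(H)}w(e)$ for distinct $u,v$ and zero diagonal entries. For a matrix $M=[m_{uv}]_{u,v\in V(H)}$, $\mathfrak{R}_M$ is the equivalence relation on $V(H)$ consisting of the pairs $(u,v)$ with $m_{uu}=m_{vv}$, $m_{uv}=m_{vu}$, and $m_{uu'}=m_{vu'}$, $m_{u'u}=m_{u'v}$ for all $u'\in V(H)\setminus\{u,v\}$.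 An equivalence relation $\mathfrak{R}_2$ is finer than $\mathfrak{R}_1$ if $(u,v)\in\mathfrak{R}_2$ implies $(u,v)\in\mathfrak{R}_1$.
   Formalization: The hypergraph is taken finite, and ''of multiplicity |W|-1'' is read as multiplicity at least |W|-1 (geometric and algebraic), since exact multiplicity fails: for K_4 with w=1 and two classes of size 2, the eigenvalue -1 has multiplicity 3. *)

(* Defs.v *)
From HB Require Import structures.
From mathcomp Require Import all_boot all_order all_algebra.
From mathcomp Require Import reals complex.

Set Implicit Arguments.
Unset Strict Implicit.
Unset Printing Implicit Defensive.

Import Order.TTheory GRing.Theory Num.Theory.
Local Open Scope ring_scope.

Record hypergraph := Hypergraph {
  vertex : finType;
  hyperedges : {set {set vertex}};
  vertex_nonempty : (0 < #|vertex|)%N;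
  hyperedges_nonempty : set0 \notin hyperedges
}.

Definition edge (H : hypergraph) : finType :=
  {e : {set vertex H} | e \in hyperedges H}.

(* Matrices whose rows and columns are indexed by finite types T and U are
   represented in 'M_(#|T|, #|U|) through the bijections enum_rank/enum_val. *)
Definition entry (K : Type) (T U : finType) (M : 'M[K]_(#|T|, #|U|))
  (t : T) (u : U) : K := M (enum_rank t) (enum_rank u).

Definition incidence (R : realType) (H : hypergraph) :
    'M[R[i]]_(#|edge H|, #|vertex H|) :=
  \matrix_(i < #|edge H|, j < #|vertex H|)
    ((enum_val j : vertex H) \in val (enum_val i : edge H))%:R.

Definition incidence_col (R : realType) (H : hypergraph) (v : vertex H) :
  edge H -> R[i] := fun e => entry (incidence R H) e v.

(* Bilinear, without complex conjugation. *)
Definition wform (R : realType) (H : hypergraph) (w : edge H -> R)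
    (x y : edge H -> R[i]) : R[i] :=
  \sum_(e : edge H) (w e)%:C%C * x e * y e.

Definition star (H : hypergraph) (v : vertex H) : {set edge H} :=
  [set e : edge H | v \in val e].

Definition adjacency (R : realType) (H : hypergraph) (w : edge H -> R) :
    'M[R[i]]_#|vertex H| :=
  \matrix_(i < #|vertex H|, j < #|vertex H|)
    if i == j then 0
    else \sum_(e in star (enum_val i) :&: star (enum_val j)) (w e)%:C%C.

Definition mx_equiv (K : eqType) (T : finType) (M : 'M[K]_#|T|) : rel T :=
  fun u v =>
    [&& entry M u u == entry M v v,
        entry M u v == entry M v u
      & [forall u' : T, (u' != u) && (u' != v) ==>
           (entry M u u' == entry M v u') && (entry M u' u == entry M u' v)]].

Definition finer (T : Type) (r2 r1 : rel T) : Prop :=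
  forall u v, r2 u v -> r1 u v.

(* Lower bound on the multiplicity of a as an eigenvalue of A, both geometric
   (dimension of the eigenspace) and algebraic (as a root of char_poly A);
   the two multiplicities coincide for real symmetric A. *)
Definition eigenvalue_of_mult_ge (F : fieldType) (n : nat) (A : 'M[F]_n)
    (a : F) (k : nat) : Prop :=
  [/\ eigenvalue A a,
      (k <= \rank (eigenspace A a))%N
    & (k <= mup a (char_poly A))%N].

(* Main.v *)
Require Import Defs.
From HB Require Import structures.
From mathcomp Require Import all_boot all_order all_algebra.
From mathcomp Require Import reals complex.

(** If two indices u and v are indistinguishable for a matrix M in the sense of
    [mx_equiv], then rows u and v of M agree outside columns u and v, while on
    these two columns they show the pattern (p, q) against (q, p) with
    p = m_uu and q = m_uv.  Hence e_u - e_v is a left eigenvector of M for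
    p - q ([twin_eigenvector]).

    Inside a class W of pairwise indistinguishable indices, the entry m_ux does
    not depend on x in W other than u ([twin_entry_const]), so the vectors
    e_x - e_u for x in W \ u share one eigenvalue.  They are linearly
    independent, since forgetting all coordinates outside W \ u turns them into
    the standard basis.  This bounds the geometric multiplicity from below by
    #|W| - 1 ([twin_class_rank_eigenspace]).  The algebraic multiplicity is at
    least the geometric one for every square matrix
    ([rank_eigenspace_le_mup]).

    For the adjacency matrix the diagonal vanishes and m_uv is (s_u, s_v)_w, so
    the common eigenvalue is -(s_u, s_v)_w. *)

Set Implicit Arguments.
Unset Strict Implicit.
Unset Printing Implicit Defensive.

Import Order.TTheory GRing.Theory Num.Theory.
Local Open Scope ring_scope.

(** A basis of the eigenspace, completed to an invertible matrix U, makes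
    'X - a%:P a common factor of the first rows of U *m ('X%:M - A).  Pulling it
    out of each of these rows, and dividing by the nonzero constant \det U,
    exhibits a power of 'X - a%:P in the characteristic polynomial. *)
Lemma rank_eigenspace_le_mup (F : fieldType) (n : nat) (A : 'M[F]_n) (a : F) :
  (\rank (eigenspace A a) <= mup a (char_poly A))%N.
Proof.
set V := eigenspace A a; set k := \rank V.
have le_kn : (k <= n)%N by exact: rank_leq_row.
have U_unit : row_ebase V \in unitmx by exact: row_ebase_unit.
set U := row_ebase V in U_unit *.
have rowU_eigen (i : 'I_n) : (i < k)%N -> row i U *m A = a *: row i U.
  move=> lt_ik; apply/eigenspaceP; rewrite -/V.
  suff -> : row i U = delta_mx 0 i *m (invmx (col_ebase V) *m V).
    by rewrite mulmxA submxMl.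
  rewrite -{2}[V]mulmx_ebase !mulmxA mulmxKV ?col_ebase_unit // -/k -/U rowE.
  congr (_ *m _); rewrite -rowE; apply/rowP => j.
  by rewrite !mxE lt_ik andbT eqxx eq_sym.
rewrite mup_geq; last exact: monic_neq0 (char_poly_monic A).
pose UP := map_mx polyC U; pose B := UP *m char_poly_mx A.
have rowB (i : 'I_n) : (i < k)%N -> row i B = ('X - a%:P) *: row i UP.
  move=> lt_ik; rewrite row_mul /char_poly_mx mulmxBr -map_row -map_mxM.
  rewrite rowU_eigen // map_mxZ mul_mx_scalar scalerBl //.
pose d := \row_(i < n) (if (i < k)%N then 'X - a%:P else 1 : {poly F}).
pose N := \matrix_(i < n) (if (i < k)%N then row i UP else row i B).
have BE : B = diag_mx d *m N.
  apply/row_matrixP => i.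
  have -> : row i (diag_mx d *m N) = d 0 i *: row i N.
    by apply/rowP => j; rewrite mul_diag_mx !mxE.
  rewrite rowK mxE.
  by case: ifP => [/rowB // | _]; rewrite scale1r.
have det_d : \det (diag_mx d) = ('X - a%:P) ^+ k.
  rewrite det_diag (eq_bigr (fun i : 'I_n =>
    if (i < k)%N then 'X - a%:P else 1 : {poly F})); last by move=> i _; rewrite mxE.
  by rewrite -big_mkcond /= (big_ord_narrow le_kn) prodr_const card_ord.
have detU_neq0 : \det U != 0 by rewrite -unitfE -unitmxE.
have detB : \det B = (\det U)%:P * char_poly A by rewrite det_mulmx det_map_mx.
by rewrite -(dvdpZr _ _ detU_neq0) -mul_polyC -detB BE det_mulmx det_d dvdp_mulr.
Qed.

Section TwinIndices.

Variables (F : fieldType) (T : finType) (M : 'M[F]_#|T|).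

Definition basis_diff (x y : T) : 'rV[F]_#|T| :=
  delta_mx 0 (enum_rank x) - delta_mx 0 (enum_rank y).

Lemma twin_eigenvector (u v : T) : mx_equiv M u v ->
  basis_diff u v *m M = (entry M u u - entry M u v) *: basis_diff u v.
Proof.
case/and3P => /eqP Duv /eqP Suv /forallP twin.
rewrite mulmxBl -!rowE; apply/rowP => j.
rewrite -(enum_valK j) !mxE /= !(inj_eq enum_rank_inj).
rewrite -!/(entry M _ _); move: (enum_val j) => z.
have [-> | zu] := eqVneq z u.
  have [<- | uv] := eqVneq u v; first by rewrite !subrr mulr0.
  by rewrite -Suv subr0 mulr1.
have [-> | zv] := eqVneq z v; first by rewrite -Duv sub0r mulrN1 opprB.
move: (twin z); rewrite zu zv /= => /andP[/eqP -> _].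
by rewrite !subrr mulr0.
Qed.

Lemma twin_entry_const (W : {set T}) (u v x : T) :
  {in W &, forall y z, mx_equiv M y z} ->
  u \in W -> v \in W -> x \in W -> v != u -> x != u ->
  entry M u x = entry M u v.
Proof.
move=> twinW uW vW xW vu xu; have /and3P[_ _ /forallP/(_ u)] := twinW _ _ xW vW.
by rewrite ![u == _]eq_sym vu xu => /andP[_ /eqP].
Qed.

Lemma twin_class_rank_eigenspace (W : {set T}) (u v : T) :
  {in W &, forall y z, mx_equiv M y z} ->
  u \in W -> v \in W -> v != u ->
  (#|W| - 1 <= \rank (eigenspace M (entry M u u - entry M u v)))%N.
Proof.
move=> twinW uW vW vu; set a := _ - _.
pose S := W :\ u; pose f (i : 'I_#|S|) : T := enum_val i.
have f_S i : (f i != u) && (f i \in W) by rewrite -in_setD1 enum_valP.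
pose D := \matrix_(i < #|S|) basis_diff (f i) u.
have D_eigen : (D <= eigenspace M a)%MS.
  apply/row_subP => i; rewrite rowK; apply/eigenspaceP.
  have /andP[fu fW] := f_S i; rewrite twin_eigenvector ?twinW //.
  have /and3P[/eqP -> /eqP -> _] := twinW _ _ fW uW.
  by rewrite (twin_entry_const twinW uW vW fW vu fu).
have D_free : row_free D.
  (* The right inverse of D keeps the coordinates in W \ u only. *)
  apply/row_freeP; exists (\matrix_(j, i) (j == enum_rank (f i))%:R).
  apply/matrixP => i j; rewrite !mxE (bigD1 (enum_rank (f j))) //= big1.
    rewrite !mxE !eqxx mulr1 addr0 /= !(inj_eq enum_rank_inj).
    have /andP[/negPf -> _] := f_S j.
    by rewrite subr0 (inj_eq enum_val_inj) eq_sym.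
  by move=> l /negPf lj; rewrite [X in _ * X]mxE lj mulr0.
by rewrite (cardsD1 u) uW addnC addnK -/S -(eqP D_free) mxrankS.
Qed.

End TwinIndices.

Section Adjacency.

Variables (R : realType) (H : hypergraph) (w : edge H -> R).

Lemma entry_adjacency_diag (u : vertex H) : entry (adjacency w) u u = 0.
Proof. by rewrite /entry mxE eqxx. Qed.

Lemma entry_adjacency (u v : vertex H) : u != v ->
  entry (adjacency w) u v = wform w (incidence_col R u) (incidence_col R v).
Proof.
move=> /negPf uv; rewrite /entry mxE (inj_eq enum_rank_inj) uv !enum_rankK.
rewrite big_mkcond; apply: eq_bigr => e _.
rewrite /incidence_col /entry !mxE !enum_rankK !inE.
by do 2!case: (_ \in val e); rewrite ?mulr1 ?mulr0.
Qed.

End Adjacency.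

Lemma equivalence_class_related (T : finType) (r : rel T) (W : {set T}) :
  equivalence_rel r -> W \in equivalence_partition r [set: T] ->
  {in W &, forall x y, r x y}.
Proof.
move=> r_equiv /imsetP[z _ ->] x y; rewrite !inE /= => zx zy.
by have [_ <-] := r_equiv z x y.
Qed.

Theorem theorem3p6 (R : realType) (H : hypergraph) (w : edge H -> R)
    (w_gt0 : forall e : edge H, 0 < w e)
    (r : rel (vertex H)) (r_equiv : equivalence_rel r)
    (r_finer : finer r (mx_equiv (adjacency w)))
    (W : {set vertex H}) (W_class : W \in equivalence_partition r [set: vertex H])
    (u v : vertex H) (uW : u \in W) (vW : v \in W) (v_neq_u : v != u) :
  eigenvalue_of_mult_ge (adjacency w)
    (- wform w (incidence_col R u) (incidence_col R v)) (#|W| - 1).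
Proof.
have twinW : {in W &, forall x y, mx_equiv (adjacency w) x y}.
  by move=> x y xW yW; apply/r_finer/(equivalence_class_related r_equiv W_class).
have := twin_class_rank_eigenspace twinW uW vW v_neq_u.
rewrite entry_adjacency_diag sub0r entry_adjacency 1?eq_sym //.
set a := - _ => rank_ge.
split=> //; last exact: leq_trans rank_ge (rank_eigenspace_le_mup _ _).
rewrite /eigenvalue -mxrank_eq0 -lt0n (leq_trans _ rank_ge) // subn_gt0.
by rewrite (cardsD1 u) uW ltnS card_gt0; apply/set0Pn; exists v; rewrite !inE v_neq_u.
Qed.
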